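(* For every connected graph $G$ of order at least $2$, $\mathrm{msd}_{\gamma_t}(G)\leq 3$.
   Context: A set $S\subseteq V(G)$ is a total dominating set of $G$ if every vertex of $G$ is adjacent to a vertex of $S$; $\gamma_t(G)$ is the minimum size of such a set. For an edge $e=uv$ and integer $t\ge1$, $G_{e,t}$ denotes the graph obtained from $G$ by replacing the edge $uv$ by a path $(u,x_1,\dots,x_t,v)$ with $t$ new vertices. $\mathrm{msd}_{\gamma_t}(uv)$ is the minimum positive integer $t$ such that $\gamma_t(G_{uv,t})>\gamma_t(G)$, and $\mathrm{msd}_{\gamma_t}(G)=\min\{\mathrm{msd}_{\gamma_t}(uv): uv\in E(G)\}$. *)

(* Defs.v *)
From mathcomp Require Import all_boot.

Set Implicit Arguments.
Unset Strict Implicit.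
Unset Printing Implicit Defensive.

Record sgraph := SGraph {
  vertex :> finType;
  adj : rel vertex;
  adj_sym : symmetric adj;
  adj_irrefl : irreflexive adj
}.

Definition connected (G : sgraph) : Prop :=
  forall u v : G, connect (@adj G) u v.

Definition total_dominating (G : sgraph) (S : {set G}) : bool :=
  [forall v : G, exists s in S, adj v s].

(* If [G] has an isolated vertex, no set is total dominating and
   [gamma_t G] is the junk value [#|G|]; otherwise [setT] is total
   dominating and this is the true minimum. *)
Definition gamma_t (G : sgraph) : nat :=
  #|[arg min_(S < [set: G] | total_dominating S) #|S| ]|.

(* [inr i] is the new vertex x_{i+1}. For [t = 0] this would only delete the
   edge uv, but it is used for [0 < t] only. *)
Definition subdivide_adj (G : sgraph) (u v : G) (t : nat) : rel (G + 'I_t) :=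
  fun x y =>
    match x, y with
    | inl a, inl b =>
        [&& adj a b, (a, b) != (u, v) & (a, b) != (v, u)]
    | inl a, inr i | inr i, inl a =>
        ((a == u) && (i == 0 :> nat)) || ((a == v) && (i.+1 == t))
    | inr i, inr j => (i.+1 == j) || (j.+1 == i)
    end.

Lemma subdivide_adj_sym (G : sgraph) (u v : G) (t : nat) :
  symmetric (@subdivide_adj G u v t).
Proof.
move=> [a|i] [b|j] //=; last by rewrite orbC.
by rewrite adj_sym !xpair_eqE andbC [(b == v) && _]andbC [(b == u) && _]andbC
           [~~ _ && ~~ _]andbC andbC.
Qed.

Lemma subdivide_adj_irrefl (G : sgraph) (u v : G) (t : nat) :
  irreflexive (@subdivide_adj G u v t).
Proof.
by move=> [a|i] /=; [rewrite adj_irrefl | rewrite orbb gtn_eqF].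
Qed.

Definition subdivide (G : sgraph) (u v : G) (t : nat) : sgraph :=
  SGraph (@subdivide_adj_sym G u v t) (@subdivide_adj_irrefl G u v t).

Lemma gamma_t_subdivide_large (G : sgraph) (u v : G) :
  exists t, (0 < t) && (gamma_t G < gamma_t (subdivide u v t)).
Proof.
pose t := #|G|.*2.+1; exists t => /=.
apply: leq_ltn_trans (max_card _) _; rewrite /gamma_t.
have [tdT|ntdT] := boolP (total_dominating [set: subdivide u v t]); last first.
  rewrite /arg_min /extremum; case: pickP => [S /andP[/forallP tdS _]|_] /=.
    case/negP: ntdT; apply/forallP => x.
    by have /exists_inP[s _ xs] := tdS x; apply/exists_inP; exists s.
  by rewrite cardsT card_sum card_ord /t -addnn addnS ltnS leq_addr.
case: arg_minnP => // S /forallP tdS _.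
pose H := subdivide u v t.
pose p (x : 'I_t) : H := odflt (inr x) [pick s in S | adj (inr x : H) s].
have pP x : (p x \in S) && adj (inr x : H) (p x).
  rewrite /p; case: pickP => [s //|no].
  by have /exists_inP[s sS xs] := tdS (inr x); have := no s; rewrite sS xs.
have fib s : #|[set x | p x == s]| <= 2.
  have sub (a b : nat) :
      (forall x : 'I_t, adj (inr x : H) s -> x = a :> nat \/ x = b :> nat) ->
      #|[set x | p x == s]| <= 2.
    move=> ab; rewrite cardE -(size_map (@nat_of_ord t)).
    apply: (@leq_trans (size [:: a; b])) => //; apply: uniq_leq_size.
      by rewrite map_inj_uniq ?enum_uniq //; apply: ord_inj.
    move=> y /mapP[x]; rewrite mem_enum inE => /eqP px ->{y}; rewrite !inE.
    by have /andP[_] := pP x; rewrite px => /ab[]->; rewrite eqxx ?orbT.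
  case: s sub => [a|i] sub.
    apply: (sub 0 t.-1) => x /= /orP[] /andP[_ /eqP Ex]; first by left.
    by right; case: Ex.
  apply: (sub i.-1 i.+1) => x /= /orP[] /eqP <-; first by left.
  by right.
have : t <= #|S| * 2.
  have {1}<- : \sum_(x < t) 1 = t by rewrite sum1_card card_ord.
  rewrite (partition_big p (mem S)) /=; last first.
    by move=> x _; case/andP: (pP x).
  rewrite -sum_nat_const; apply: leq_sum => s _.
  by apply: leq_trans (fib s); rewrite sum1dep_card.
by rewrite muln2 /t ltn_double.
Qed.

(* As subdividing uv and vu give isomorphic graphs, edges may be given as
   ordered pairs. The minimised predicate is that of the existence lemma,
   which holds for every pair [u, v]; only edges are used below. *)
Definition msd_edge (G : sgraph) (u v : G) : nat :=
  ex_minn (gamma_t_subdivide_large u v).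

Definition is_msd_value (G : sgraph) (m : nat) : bool :=
  [exists u : G, exists v : G, adj u v && (msd_edge u v == m)].

Lemma connected_msd_value (G : sgraph) :
  connected G -> 1 < #|G| -> exists m, is_msd_value G m.
Proof.
move=> conG /card_gt1P[u [v [_ _ uv]]].
have /connectP[[|w p] /= pth vE] := conG u v; first by rewrite vE eqxx in uv.
case/andP: pth => uw _; exists (msd_edge u w).
by apply/existsP; exists u; apply/existsP; exists w; rewrite uw eqxx.
Qed.

(* [msd] is only meaningful for graphs with at least one edge; the two
   hypotheses serve to show that the set being minimised is nonempty. *)
Definition msd (G : sgraph) (conG : connected G) (ordG : 1 < #|G|) : nat :=
  ex_minn (connected_msd_value conG ordG).

(* Main.v *)
(* Subdividing any edge [uv] three times increases [gamma_t]. Given a total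
   dominating set [S] of the subdivided graph with new path x1, x2, x3, delete
   the new vertices from [S], adding [v] if x1 was in [S] and [u] if x3 was: the
   edge [uv] then takes over the domination of [u] by x1 and of [v] by x3. If
   x2 is in [S], this loses at least the vertex x2. Otherwise x1 and x3 force
   [u] and [v] to be in [S], so nothing is added, while x1 or x3, one of which is
   needed to dominate x2, is lost. *)
Require Import Defs.
From mathcomp Require Import all_boot.

Lemma total_dominatingP (G : sgraph) (S : {set G}) :
  reflect (forall a, exists2 s, s \in S & adj a s) (total_dominating S).
Proof. by apply: (iffP forallP) => tdS a; apply/exists_inP. Qed.

(** The hypothesis makes the default [[set: G]] of the [arg min] admissible, so that [gamma_t] is a
    true minimum. *)
Lemma gamma_tP (G : sgraph) : total_dominating [set: G] ->
  exists2 S : {set G}, total_dominating S & #|S| = gamma_t G.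
Proof.
by move=> tdT; rewrite /gamma_t; case: arg_minnP => // S tdS _; exists S.
Qed.

Lemma gamma_t_min (G : sgraph) (S : {set G}) :
  total_dominating S -> gamma_t G <= #|S|.
Proof.
move=> tdS; have tdT : total_dominating [set: G].
  apply/total_dominatingP => a.
  by have [s _ ?] := total_dominatingP _ _ tdS a; exists s.
by rewrite /gamma_t; case: arg_minnP => // S0 _; apply.
Qed.

(** The first edge of a path from [a] to another vertex gives a neighbour of [a]. *)
Lemma connected_total_dominating_setT (G : sgraph) :
  connected G -> 1 < #|G| -> total_dominating [set: G].
Proof.
move=> conG ordG; apply/total_dominatingP => a.
have /set0Pn[b] : [set~ a] != set0 by rewrite -card_gt0 cardsC1 -ltnS prednK // ltnW.
rewrite !inE => ba; have /connectP[[|c p] /= pth E] := conG a b.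
  by rewrite E eqxx in ba.
by case/andP: pth => ac _; exists c.
Qed.

(** This keeps [gamma_t] of the subdivided graph from being the junk value. If the neighbour found
    in [G] is lost with the edge [uv], an end of the new path replaces it. *)
Lemma subdivide_total_dominating_setT (G : sgraph) (u v : G) (t : nat) :
  1 < t -> total_dominating [set: G] ->
  total_dominating [set: subdivide u v t].
Proof.
move=> t1 tdT; have t0 := ltnW t1; apply/total_dominatingP => -[a|i].
- have [b _ ab] := total_dominatingP _ _ tdT a.
  have [/eqP[-> _]|uv] := boolP ((a, b) == (u, v)).
    by exists (inr (Ordinal t0)); rewrite ?inE //= eqxx.
  have [/eqP[-> _]|vu] := boolP ((a, b) == (v, u)).
    have lt_t : t.-1 < t by rewrite prednK.
    by exists (inr (Ordinal lt_t)); rewrite ?inE //= prednK // !eqxx orbT.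
  by exists (inl b); rewrite ?inE //= ab uv vu.
- have [i0|i_gt0] := posnP i.
    by exists (inl u); rewrite ?inE //= i0 !eqxx.
  have lt_i : i.-1 < t by apply: leq_ltn_trans (leq_pred i) (ltn_ord i).
  by exists (inr (Ordinal lt_i)); rewrite ?inE //= prednK // eqxx orbT.
Qed.

Lemma subdivide3_total_dominating (G : sgraph) (u v : G)
    (S : {set subdivide u v 3}) :
  adj u v -> total_dominating S ->
  exists2 S' : {set G}, total_dominating S' & #|S'| < #|S|.
Proof.
move=> uv /total_dominatingP tdS.
pose D : {set G} := [set a | inl a \in S].
pose x1 : subdivide u v 3 := inr (@Ordinal 3 0 isT).
pose x2 : subdivide u v 3 := inr (@Ordinal 3 1 isT).
pose x3 : subdivide u v 3 := inr (@Ordinal 3 2 isT).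
have inrP (i : 'I_3) : [\/ inr i = x1, inr i = x2 | inr i = x3].
  by case: i => [[|[|[|]]] lti] //; [apply: Or31 | apply: Or32 | apply: Or33];
    congr inr; apply: val_inj.
(* Among the old vertices, only [u] and [v] have new neighbours, namely [x1] and [x3]. *)
have dom_inl a : (exists2 s, s \in D & adj a s) \/
    (a = u /\ x1 \in S \/ a = v /\ x3 \in S).
  have [[b|i] sS] := tdS (inl a).
    by case/and3P=> ab _ _; left; exists b; rewrite ?inE.
  case: (inrP i) sS => -> sS /=; rewrite ?andbF ?andbT ?orbF //= => /eqP ->.
    by right; left.
  by right; right.
have dom1 : u \in D \/ x2 \in S.
  have [[b|i] sS] := tdS x1.
    by rewrite /= andbT andbF orbF => /eqP <-; left; rewrite inE.
  by case: (inrP i) sS => -> //; right.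
have dom2 : x1 \in S \/ x3 \in S.
  have [[b|i] sS] := tdS x2; first by rewrite /= !andbF.
  by case: (inrP i) sS => -> // ? _; [left | right].
have dom3 : v \in D \/ x2 \in S.
  have [[b|i] sS] := tdS x3.
    by rewrite /= andbT andbF => /eqP <-; left; rewrite inE.
  by case: (inrP i) sS => -> //; right.
have cardS : #|S| = #|D| + ((x1 \in S) + (x2 \in S) + (x3 \in S)).
  rewrite -sum1_card big_sumType /= sum1dep_card; congr (_ + _).
  rewrite big_mkcond !big_ord_recl big_ord0 /= addn0 addnA.
  have -> : inr ord0 = x1 by congr inr; apply: val_inj.
  have -> : inr (lift ord0 ord0) = x2 by congr inr; apply: val_inj.
  by have -> : inr (lift ord0 (lift ord0 ord0)) = x3 by congr inr; apply: val_inj.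
(* A conditional singleton, whose size is the boolean that [cardS] counts. *)
pose E b (a : G) := if b then [set a] else set0.
exists (D :|: E (x1 \in S) v :|: E (x3 \in S) u).
  apply/total_dominatingP => a.
  have [[s sD as_]|[[-> x1S]|[-> x3S]]] := dom_inl a.
  - by exists s; rewrite // inE inE sD.
  - by exists v; rewrite // x1S !inE eqxx orbT.
  - by exists u; rewrite ?x3S ?inE ?eqxx ?orbT // adj_sym.
rewrite cardS.
have cardE b a : #|E b a| = b by case: b; rewrite ?cards1 ?cards0.
have [x2S|x2S] := boolP (x2 \in S).
  (* Here [x1] and [x3] pay for the added [v] and [u], and [x2] gives strictness. *)
  rewrite addn1 addSn addnS ltnS addnA.
  apply: leq_trans (leq_card_setU _ _) _; rewrite cardE leq_add2r.
  by apply: leq_trans (leq_card_setU _ _) _; rewrite cardE.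
(* Without [x2], both [E] terms are absorbed by [D], and [dom2] gives strictness. *)
have sub b a : a \in D -> E b a \subset D.
  by case: b => aD; rewrite ?sub1set ?sub0set.
have uD : u \in D by case: dom1 => // /negPn; rewrite x2S.
have vD : v \in D by case: dom3 => // /negPn; rewrite x2S.
rewrite (setUidPl (sub _ _ vD)) (setUidPl (sub _ _ uD)) -addn1 leq_add2l.
by case: dom2 => ->; rewrite // addnC.
Qed.

Lemma gamma_t_subdivide3 (G : sgraph) (u v : G) :
  total_dominating [set: G] -> adj u v ->
  gamma_t G < gamma_t (subdivide u v 3).
Proof.
move=> tdT uv.
have [S tdS <-] := gamma_tP _ (subdivide_total_dominating_setT _ u v 3 isT tdT).
have [S' tdS' ltS'] := subdivide3_total_dominating _ _ _ _ uv tdS.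
exact: leq_ltn_trans (gamma_t_min _ _ tdS') ltS'.
Qed.

Theorem theorem7 (G : sgraph) (conG : connected G) (ordG : 1 < #|G|) :
  msd conG ordG <= 3.
Proof.
(* The minimum is attained at some edge [uv], and there 3 already satisfies the predicate that
   [msd_edge] minimises. *)
rewrite /msd; case: ex_minnP => m /existsP[u /existsP[v /andP[uv /eqP <-]]] _.
rewrite /msd_edge; case: ex_minnP => t _; apply.
by rewrite gamma_t_subdivide3 ?connected_total_dominating_setT.
Qed.
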